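(* Let $\mathcal{A}$ be a finitely presented algebra over a field $F$ with a non-zero two-sided ideal $I\vartriangleleft\mathcal{A}$ such that: (i) the ideal $I$ is finitely generated as a left ideal of $\mathcal{A}$; (ii) the algebra $\mathcal{A}/I$ is amenable; and (iii) $\mathcal{A}/I$ has no finite-dimensional representations. Then $\mathcal{A}$ is not rank-stable.
   Context: Algebras are associative and unital over a field $F$; $F\langle x_1,\dots,x_d\rangle$ denotes the free associative unital algebra (non-commutative polynomials). A finite-dimensional representation of an algebra is a unital algebra homomorphism to $M_n(F)$ for some $n\ge1$. For $A\in M_n(F)$ let $\operatorname{rank}(A)=\dim_F\operatorname{Im}A$ and let $\operatorname{rk}(A)=\frac1n\operatorname{rank}(A)$ (normalized rank). For $A\in M_n(F)$, $\widehat{A}$ is the finitely supported $\mathbb{N}\times\mathbb{N}$ matrix that agrees with $A$ in entries $(i,j)$ with $1\le i,j\le n$ and is zero elsewhere. When matrices in $M_n(F)$ are substituted into a non-commutative polynomial, constant terms are interpreted as scalar $n\times n$ matrices. A finitely presented algebra $F\langle x_1,\dots,x_d\rangle/\langle P_1,\dots,P_r\rangle$ is rank-stable if for every $\varepsilon>0$ there exists $\delta>0$ such that for every $n\ge 1$ and every tuple $A_1,\dots,A_d\in M_n(F)$ with $\operatorname{rk}P_i(A_1,\dots,A_d)<\delta$ for all $1\le i\le r$, there exist $n'\ge 1$ and $B_1,\dots,B_d\in M_{n'}(F)$ with $P_i(B_1,\dots,B_d)=0$ for all $1\le i\le r$ and $\operatorname{rank}(\widehat{A_i}-\widehat{B_i})<\varepsilon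 n$ for all $1\le i\le d$. (This property does not depend on the chosen finite presentation of the algebra.) A finitely generated algebra $\mathcal{B}$ with finite generating set $S$ is amenable if for every $\varepsilon>0$ there exists a finite-dimensional subspace $V\le\mathcal{B}$ such that $\dim_F(SV+V)<(1+\varepsilon)\dim_F V$, where $SV$ is the linear span of all products $sv$ with $s\in S$, $v\in V$. *)

(* Defs.v *)
From HB Require Import structures.
From mathcomp Require Import all_boot all_order all_algebra.
From mathcomp Require Import classical_sets reals.
From mathcomp Require Export monalg.

Set Implicit Arguments.
Unset Strict Implicit.
Unset Printing Implicit Defensive.

Import Order.TTheory GRing.Theory Num.Theory.
Local Open Scope classical_set_scope.
Local Open Scope ring_scope.

(* F<x_0, ..., x_(d-1)>: the monoid algebra of the free monoid on 'I_d. *)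
Notation ncpoly F d := {malg F[{fmonom 'I_d}]}.

(* The constant term c is sent to c%:A, i.e. to a scalar matrix in 'M_n.+1. *)
Definition nc_eval (F : fieldType) (d : nat) (B : algType F) (b : 'I_d -> B)
    (P : ncpoly F d) : B :=
  mmap (fun c : F => c%:A) (fun m : {fmonom 'I_d} => \prod_(i <- m) b i) P.

Definition generates (F : fieldType) (d : nat) (B : algType F)
    (b : 'I_d -> B) : Prop :=
  forall x : B, exists Q : ncpoly F d, nc_eval b Q = x.

(* Closure under opposites and scalars follows from absorption, rings and
   algebras being unital. *)
Definition two_sided_ideal (A : pzRingType) (I : set A) : Prop :=
  [/\ I 0,
      forall x y, I x -> I y -> I (x + y)
    & forall a x, I x -> I (a * x) /\ I (x * a)].

Definition ideal_generated (A : pzRingType) (r : nat) (P : 'I_r -> A) : set A :=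
  [set Q | forall J : set A, two_sided_ideal J -> (forall i, J (P i)) -> J Q].

(* By the first isomorphism theorem, A is the quotient of F<x_0, ..., x_(d-1)>
   by <P_0, ..., P_(r-1)>, the class of x_i corresponding to a i. *)
Definition presentation (F : fieldType) (A : algType F) (d r : nat)
    (P : 'I_r -> ncpoly F d) (a : 'I_d -> A) : Prop :=
  generates a /\
  forall Q : ncpoly F d, nc_eval a Q = 0 <-> ideal_generated P Q.

Definition finitely_presented (F : fieldType) (A : algType F) : Prop :=
  exists (d r : nat) (P : 'I_r -> ncpoly F d) (a : 'I_d -> A),
    presentation P a.

Definition rk (R : realType) (F : fieldType) (n : nat) (M : 'M[F]_n) : R :=
  (\rank M)%:R / n%:R.

Definition hat (F : fieldType) (n : nat) (M : 'M[F]_n) (i j : nat) : F :=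
  if (insub i, insub j) is (Some i', Some j') then M i' j' else 0.

(* The rank of the N x N matrix hat M - hat M', which vanishes outside its
   upper left corner of size maxn n n'. *)
Definition rank_hat_sub (F : fieldType) (n n' : nat)
    (M : 'M[F]_n) (M' : 'M[F]_n') : nat :=
  \rank (\matrix_(i < maxn n n', j < maxn n n') (hat M i j - hat M' i j)).

(* Matrix sizes n >= 1 are written n.+1. *)
Definition rank_stable_relations (R : realType) (F : fieldType) (d r : nat)
    (P : 'I_r -> ncpoly F d) : Prop :=
  forall eps : R, 0 < eps -> exists delta : R, 0 < delta /\
    forall (n : nat) (A : 'I_d -> 'M[F]_n.+1),
      (forall i : 'I_r, rk R (nc_eval A (P i)) < delta) ->
      exists (n' : nat) (B : 'I_d -> 'M[F]_n'.+1),
        (forall i : 'I_r, nc_eval B (P i) = 0) /\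
        (forall i : 'I_d, (rank_hat_sub (A i) (B i))%:R < eps * n.+1%:R).

(* The property is independent of the presentation. With the existential
   quantifier used here, "not rank-stable" means that no finite presentation
   of A satisfies the stability condition. *)
Definition rank_stable (R : realType) (F : fieldType) (A : algType F) : Prop :=
  exists (d r : nat) (P : 'I_r -> ncpoly F d) (a : 'I_d -> A),
    presentation P a /\ rank_stable_relations R P.

Definition linear_span (F : fieldType) (V : lmodType F) (X : set V) : set V :=
  [set x | exists (k : nat) (c : 'I_k -> F) (v : 'I_k -> V),
     (forall i, X (v i)) /\ x = \sum_i c i *: v i].

Definition linearly_independent (F : fieldType) (V : lmodType F) (k : nat)
    (e : 'I_k -> V) : Prop :=
  forall c : 'I_k -> F, \sum_i c i *: e i = 0 -> forall i, c i = 0.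

(* W is a subspace of dimension k: it has a basis of k vectors. *)
Definition has_dim (F : fieldType) (V : lmodType F) (W : set V) (k : nat) :
    Prop :=
  exists e : 'I_k -> V, linearly_independent e /\ W = linear_span (range e).

Definition span_mul (F : fieldType) (B : algType F) (S V : set B) : set B :=
  linear_span [set s * v | s in S & v in V].

Definition sum_subspace (F : fieldType) (B : lmodType F) (U V : set B) :
    set B :=
  [set u + v | u in U & v in V].

(* The generating set S is the range of a finite family; the condition does
   not depend on S. The strict inequality forces V to be nonzero. *)
Definition amenable (R : realType) (F : fieldType) (B : algType F) : Prop :=
  exists (k : nat) (s : 'I_k -> B), generates s /\
    forall eps : R, 0 < eps ->
      exists (V : set B) (m l : nat),
        [/\ has_dim V m,
            has_dim (sum_subspace (span_mul (range s) V) V) l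
          & l%:R < (1 + eps) * m%:R].

Definition fg_left_ideal (A : pzRingType) (I : set A) : Prop :=
  exists (k : nat) (g : 'I_k -> A),
    I = [set x | exists c : 'I_k -> A, x = \sum_i c i * g i].

Definition has_findim_rep (F : fieldType) (B : algType F) : Prop :=
  exists n : nat, inhabited {lrmorphism B -> 'M[F]_n.+1}.

(* B, with the projection q, is the quotient A / I. An algType being nonzero,
   I is then proper; the zero algebra is not amenable in the above sense. *)
Definition is_quotient (F : fieldType) (A B : algType F) (I : set A)
    (q : {lrmorphism A -> B}) : Prop :=
  (forall y : B, exists x : A, q x = y) /\
  (forall x : A, q x = 0 <-> I x).

(* Main.v *)
Require Import Defs.
From HB Require Import structures.
From mathcomp Require Import all_boot all_order all_algebra.
From mathcomp Require Import classical_sets reals.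
From mathcomp Require Import finmap boolp.
Set Implicit Arguments.
Unset Strict Implicit.
Unset Printing Implicit Defensive.
Import Order.TTheory GRing.Theory Num.Theory.
Local Open Scope ring_scope.

(* Let x be the images in B = A / I of the generators of A. On a Folner
   subspace V of B, left multiplication by x, cut back to V, gives matrices M
   that satisfy every relation of B up to rank o(dim V). As B has no
   one-dimensional representation, some polynomial h without constant term has
   h(x) = 1, so h(M) has almost full rank. If N is an exact representation of A
   close to M, then h(N) still has rank close to dim V: for polynomials without
   constant term the size of N is irrelevant. Let I be generated as a left
   ideal by the G_i(a). The common kernel of the G_i(N) is a
   finite-dimensional B-module, hence zero, so rank h(N) is at most the sum of
   the ranks of (G_i h)(N), which are close to the ranks of (G_i h)(M). The
   latter are small since G_i h vanishes in B: a contradiction. *)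

(** * Evaluation of non-commutative polynomials as an algebra morphism *)

Section NCEval.
Variables (F : fieldType) (d : nat) (B : algType F) (b : 'I_d -> B).

Definition word_eval (m : {fmonom 'I_d}) : B := \prod_(i <- m) b i.

Lemma word_eval_mmorphism : mmorphism word_eval.
Proof.
split=> [m1 m2|]; first by rewrite /word_eval fmM big_cat.
by rewrite /word_eval fm1 big_nil.
Qed.

HB.instance Definition _ :=
  monalg.isMultiplicative.Build {fmonom 'I_d} B word_eval word_eval_mmorphism.

Lemma nc_evalE : nc_eval b = mmap (in_alg B) word_eval.
Proof. by []. Qed.

Lemma nc_eval_zmod_morphism : zmod_morphism (nc_eval b).
Proof. by rewrite nc_evalE; exact: raddfB. Qed.

Lemma nc_eval_monoid_morphism : monoid_morphism (nc_eval b).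
Proof.
rewrite nc_evalE.
have [M1 M2] : multiplicative (mmap (in_alg B) word_eval).
  apply: commr_mmap_is_multiplicative => Q m m' /=.
  by rewrite /GRing.comm mulr_algl mulr_algr.
by split.
Qed.

Lemma nc_eval_scalable : scalable (nc_eval b).
Proof. by move=> c Q; rewrite nc_evalE mmapZ mulr_algl. Qed.

HB.instance Definition _ := GRing.isZmodMorphism.Build _ _ (nc_eval b)
  nc_eval_zmod_morphism.
HB.instance Definition _ := GRing.isMonoidMorphism.Build _ _ (nc_eval b)
  nc_eval_monoid_morphism.
HB.instance Definition _ := GRing.isScalable.Build F _ _ _ (nc_eval b)
  nc_eval_scalable.

Lemma nc_eval_sum (Q : ncpoly F d) :
  nc_eval b Q = \sum_(m <- msupp Q) Q@_m *: word_eval m.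
Proof. by apply: eq_bigr => m _; rewrite mulr_algl. Qed.

End NCEval.

Lemma nc_eval_comp (F : fieldType) (d : nat) (A B : algType F)
    (f : {lrmorphism A -> B}) (a : 'I_d -> A) (Q : ncpoly F d) :
  nc_eval (f \o a) Q = f (nc_eval a Q).
Proof.
rewrite !nc_eval_sum linear_sum; apply: eq_bigr => m _.
by rewrite linearZ /word_eval rmorph_prod.
Qed.

(** * Modules over the quotient and common kernels *)

Lemma lrmorphism_factor (F : fieldType) (T : lalgType F) (B C : algType F)
    (e : {lrmorphism T -> B}) (f : {lrmorphism T -> C}) :
    (forall y, exists x, e x = y) -> (forall x, e x = 0 -> f x = 0) ->
  inhabited {lrmorphism B -> C}.
Proof.
move=> /choice[s sK] ef0; pose g := f \o s.
(* The value of [g] is independent of the preimage chosen by [s], so each morphism law can be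
   checked on a convenient preimage. *)
have gP x y : e x = y -> g y = f x.
  move=> exy; apply/eqP; rewrite -subr_eq0 -linearB; apply/eqP/ef0.
  by rewrite linearB /= sK exy subrr.
have gB : zmod_morphism g.
  by move=> x y; rewrite (gP (s x - s y)) linearB //= !sK.
have gM : monoid_morphism g.
  split; first by rewrite (gP 1) ?rmorph1.
  by move=> x y; rewrite (gP (s x * s y)) rmorphM //= !sK.
have gZ : scalable g.
  by move=> c x; rewrite (gP (c *: s x)) linearZ //= sK.
pose m1 := GRing.isZmodMorphism.Build _ _ g gB.
pose m2 := GRing.isMonoidMorphism.Build _ _ g gM.
pose m3 := GRing.isScalable.Build F _ _ _ g gZ.
pose G : {lrmorphism B -> C} := HB.pack g m1 m2 m3.
exact: inhabits G.
Qed.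

(* Restriction to the invariant subspace spanned by the columns of [U]. *)
Lemma lrmorphism_restrict (F : fieldType) (T : lalgType F) (n k : nat)
    (f : {lrmorphism T -> 'M[F]_n.+1}) (U : 'M_(n.+1, k.+1)) X :
    X *m U = 1%:M -> (forall t, U *m (X *m (f t *m U)) = f t *m U) ->
  exists g : {lrmorphism T -> 'M[F]_k.+1}, forall t, g t = X *m (f t *m U).
Proof.
move=> XU fU; pose g t : 'M_k.+1 := X *m (f t *m U).
have gB : zmod_morphism g.
  by move=> x y; rewrite /g linearB mulmxBl mulmxBr.
have gM : monoid_morphism g.
  split=> [|x y]; first by rewrite /g rmorph1 mul1mx.
  by rewrite /g rmorphM -!mulmxE -!mulmxA fU.
have gZ : scalable g.
  by move=> c x; rewrite /g linearZ /= -scalemxAl -scalemxAr.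
pose m1 := GRing.isZmodMorphism.Build _ _ g gB.
pose m2 := GRing.isMonoidMorphism.Build _ _ g gM.
pose m3 := GRing.isScalable.Build F _ _ _ g gZ.
pose G : {lrmorphism T -> 'M[F]_k.+1} := HB.pack g m1 m2 m3.
by exists G.
Qed.

(** The columns of [U] form a basis of the kernel and [U *m X] projects onto it; transposes appear
    since [kermx] concerns row vectors. The positive size [k.+1] is what a representation on this
    kernel requires. *)
Lemma column_kernel (F : fieldType) (p n : nat) (G : 'M[F]_(p, n)) :
    (\rank G < n)%N ->
  exists (k : nat) (U : 'M_(n, k.+1)) (X : 'M_(k.+1, n)),
    [/\ X *m U = 1%:M, G *m U = 0
      & forall q (v : 'M_(n, q)), G *m v = 0 -> U *m (X *m v) = v].
Proof.
move=> ltGn; set K := kermx G^T.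
have [r [U [rE fU UK]]] : exists r (U : 'M_(r, n)),
    [/\ r = \rank K, row_free U & (U :=: K)%MS].
  exists (\rank K), (row_base K); split=> //.
    exact: row_base_free.
  exact: eq_row_base.
have : (0 < r)%N by rewrite rE mxrank_ker mxrank_tr subn_gt0.
case: r U {rE} fU UK => // k U fU UK _.
have [X UX] := row_freeP fU.
exists k, U^T, X^T; split.
- by rewrite -trmx_mul UX trmx1.
- apply: trmx_inj; rewrite trmx_mul trmxK trmx0; apply/sub_kermxP.
  by rewrite UK.
- move=> q v Gv0; apply: trmx_inj; rewrite !trmx_mul !trmxK.
  have : (v^T <= U)%MS.
    by rewrite UK; apply/sub_kermxP; rewrite -trmx_mul Gv0 trmx0.
  by case/submxP=> D ->; rewrite -(mulmxA D) UX mulmx1.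
Qed.

(* The common kernel of the [f (g i)] is a module over [T / ker e], that is,
   over [B]. *)
Lemma mxrank_le_sum_mul (F : fieldType) (T : lalgType F) (B : algType F)
    (n k : nat) (e : {lrmorphism T -> B}) (f : {lrmorphism T -> 'M[F]_n.+1})
    (g : 'I_k -> T) (h : 'M[F]_n.+1) :
    (forall y, exists x, e x = y) -> (forall i, e (g i) = 0) ->
    (forall t, e t = 0 -> exists c : 'I_k -> T, f t = \sum_i f (c i * g i)) ->
    ~ has_findim_rep B ->
  (\rank h <= \sum_i \rank (f (g i) *m h))%N.
Proof.
move=> eS eg0 eker norep; pose G := (\sum_i f (g i))%MS.
have GE q (v : 'M_(n.+1, q)) : G *m v = 0 <-> forall i, f (g i) *m v = 0.
  split=> [Gv0 i|fv0].
    have : (f (g i) *m v <= G *m v)%MS.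
      by apply: submxMr; rewrite /G (sumsmx_sup i).
    by rewrite Gv0 => /submx0null.
  apply/eqP; rewrite -submx0 /G sumsmxMr_gen; apply/sumsmx_subP => i _.
  by rewrite genmxE fv0 sub0mx.
have rG : \rank G = n.+1.
  apply/eqP; rewrite eqn_leq rank_leq_col leqNgt; apply/negP => ltG.
  have [l [U [X [XU GU kerG]]]] := column_kernel ltG.
  have kill t : e t = 0 -> f t *m U = 0.
    move=> /eker[c ->]; rewrite mulmx_suml big1 // => i _.
    rewrite rmorphM -mulmxE -mulmxA.
    by have /GE-> := GU; rewrite mulmx0.
  (* The kernel is invariant: [g i * t] lies in the kernel of [e] because [g i] does, so it acts on
     [U] by zero. *)
  have [|f' f'E] := lrmorphism_restrict XU (f := f).
    move=> t; apply: kerG; apply/GE => i.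
    rewrite mulmxA mulmxE -rmorphM; apply: kill.
    by rewrite rmorphM /= eg0 mul0r.
  apply: norep; exists l; apply: (lrmorphism_factor (f := f') eS).
  by move=> t /kill ft0; rewrite f'E ft0 mulmx0.
(* [G] has full rank, so multiplying by it preserves the rank of [h]; ranks are subadditive over
   sums of row spaces. *)
have -> : \rank h = \rank (G *m h).
  by rewrite (eqmxMfull h) // /row_full rG.
rewrite /G sumsmxMr.
elim/big_rec2: _ => [|i r X _ rX]; first by rewrite mxrank0.
by rewrite (leq_trans (mxrank_adds_leqif _ _)) ?leq_add2l.
Qed.

(** * Rank perturbation across matrix sizes *)

(** Serves as a Lipschitz constant of evaluation, for ranks and for codimensions: each occurrence of
    a variable contributes the error once, whatever the coefficient. *)
Definition nc_length (F : fieldType) (d : nat) (Q : ncpoly F d) : nat :=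
  (\sum_(m <- msupp Q) size m)%N.

Lemma mxrank_sum_le (F : fieldType) (m n : nat) (I : Type) (r : seq I)
    (A : I -> 'M[F]_(m, n)) :
  (\rank (\sum_(i <- r) A i)%R <= \sum_(i <- r) \rank (A i))%N.
Proof.
elim: r => [|i r IH]; first by rewrite !big_nil mxrank0.
by rewrite !big_cons (leq_trans (mxrank_add _ _)) // leq_add2l.
Qed.

(* The constant terms are excluded since [M |-> J *m M *m J'] is
   multiplicative but not unital. *)
Lemma mxrank_corner_sub_nc_eval (F : fieldType) (d n n' N e : nat)
    (J : 'M[F]_(N, n.+1)) J' (K : 'M[F]_(N, n'.+1)) K'
    (A : 'I_d -> 'M[F]_n.+1) (B : 'I_d -> 'M[F]_n'.+1) (Q : ncpoly F d) :
    J' *m J = 1%:M -> K' *m K = 1%:M ->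
    (forall i, \rank (J *m A i *m J' - K *m B i *m K')%R <= e)%N ->
    Q@_mone = 0 ->
  (\rank (J *m nc_eval A Q *m J' - K *m nc_eval B Q *m K')%R
     <= nc_length Q * e)%N.
Proof.
move=> J'J K'K ABe Q1.
have word (s : seq 'I_d) : s != [::] ->
    (\rank (J *m (\prod_(i <- s) A i)%R *m J'
            - K *m (\prod_(i <- s) B i)%R *m K')%R <= size s * e)%N.
  elim: s => // i [_ _|j s IH _]; first by rewrite !big_seq1 mul1n.
  move/(_ isT): IH; move: (j :: s) => t; rewrite !big_cons /=.
  set P := (\prod_(_ <- _) _)%R; set P' := (\prod_(_ <- _) _)%R => IH.
  (* Telescoping: change the first letter, then the rest of the word. The left inverses make both
     corner embeddings multiplicative. *)
  have -> : J *m (A i * P)%R *m J' - K *m (B i * P')%R *m K'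
      = (J *m A i *m J' - K *m B i *m K') *m (J *m P *m J')
        + (K *m B i *m K') *m (J *m P *m J' - K *m P' *m K').
    rewrite mulmxBl mulmxBr addrA subrK -!mulmxE -!mulmxA.
    by rewrite (mulmxA J') J'J mul1mx (mulmxA K') K'K mul1mx.
  rewrite mulSn (leq_trans (mxrank_add _ _)) // leq_add //.
    exact: leq_trans (mxrankM_maxl _ _) (ABe i).
  exact: leq_trans (mxrankM_maxr _ _) IH.
rewrite !nc_eval_sum !mulmx_sumr !mulmx_suml -sumrB.
apply: leq_trans (mxrank_sum_le _ _) _.
rewrite /nc_length big_distrl /= !big_seq leq_sum // => m mQ.
have m0 : (m : seq _) != [::].
  apply: contraL mQ => /eqP m0.
  have -> : m = mone by apply: fdeg_eq0I; rewrite fdegE m0.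
  by rewrite -mcoeff_eq0 Q1.
rewrite -!scalemxAr -!scalemxAl -scalerBr.
by rewrite (leq_trans (mxrank_scale _ _)) // word.
Qed.

(** Turns entrywise padding into a corner embedding, to which the preceding estimate applies. *)
Lemma hat_corner (F : fieldType) (n N : nat) (M : 'M[F]_n) : (n <= N)%N ->
  \matrix_(i < N, j < N) hat M i j
    = (pid_mx n : 'M_(N, n)) *m M *m (pid_mx n : 'M_(n, N)).
Proof.
move=> leN; apply/matrixP => i j; rewrite !mxE /hat.
have pidL (k : 'I_n) : (pid_mx n : 'M[F]_(N, n)) i k = (i == k :> nat)%:R.
  by rewrite mxE; case: eqP => //= ->; rewrite ltn_ord.
have pidR (k : 'I_n) : (pid_mx n : 'M[F]_(n, N)) k j = (k == j :> nat)%:R.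
  by rewrite mxE ltn_ord andbT.
under eq_bigr => k _ do rewrite mxE pidR.
case: insubP => [i' _ i'E|/negP niN]; last first.
  rewrite big1 // => k _; rewrite big1 ?mul0r // => l _.
  rewrite pidL; case: eqP => [il|_]; last by rewrite mul0r.
  by case: niN; rewrite il ltn_ord.
case: insubP => [j' _ j'E|/negP njN]; last first.
  rewrite big1 // => k _; case: eqP => [kj|_]; last by rewrite mulr0.
  by case: njN; rewrite -kj ltn_ord.
rewrite (bigD1 j') //= j'E eqxx mulr1 [X in _ + X]big1 ?addr0; last first.
  by move=> k kj; rewrite -j'E val_eqE (negbTE kj) mulr0.
rewrite (bigD1 i') //= pidL i'E eqxx mul1r big1 ?addr0 //.
by move=> k ki; rewrite pidL -i'E val_eqE eq_sym (negbTE ki) mul0r.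
Qed.

Lemma mxrank_corner (F : fieldType) (n N : nat) (J : 'M[F]_(N, n)) J'
    (M : 'M[F]_n) :
  J' *m J = 1%:M -> \rank (J *m M *m J') = \rank M.
Proof.
move=> J'J; apply/eqP; rewrite eqn_leq; apply/andP; split.
  exact: leq_trans (mxrankM_maxl _ _) (mxrankM_maxr _ _).
have {1}-> : M = J' *m (J *m M *m J') *m J.
  by rewrite !mulmxA J'J mul1mx -mulmxA J'J mulmx1.
exact: leq_trans (mxrankM_maxl _ _) (mxrankM_maxr _ _).
Qed.

Lemma mxrank_le_sub (F : fieldType) (m n : nat) (X Y : 'M[F]_(m, n)) :
  (\rank X <= \rank Y + \rank (X - Y)%R)%N.
Proof. by rewrite -{1}(subrK Y X) addnC mxrank_add. Qed.

(** Both values are padded to the common size [N]; padding preserves ranks, and the padded values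
    differ by rank at most [nc_length Q * e]. *)
Lemma mxrank_nc_eval_hat (F : fieldType) (d n n' e : nat)
    (A : 'I_d -> 'M[F]_n.+1) (B : 'I_d -> 'M[F]_n'.+1) (Q : ncpoly F d) :
    (forall i, rank_hat_sub (A i) (B i) <= e)%N -> Q@_mone = 0 ->
  (\rank (nc_eval A Q) <= \rank (nc_eval B Q) + nc_length Q * e)%N /\
  (\rank (nc_eval B Q) <= \rank (nc_eval A Q) + nc_length Q * e)%N.
Proof.
move=> ABe Q1; pose N := maxn n.+1 n'.+1.
have ln : (n.+1 <= N)%N by rewrite leq_maxl.
have ln' : (n'.+1 <= N)%N by rewrite leq_maxr.
pose J : 'M[F]_(N, n.+1) := pid_mx n.+1.
pose J' : 'M[F]_(n.+1, N) := pid_mx n.+1.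
pose K : 'M[F]_(N, n'.+1) := pid_mx n'.+1.
pose K' : 'M[F]_(n'.+1, N) := pid_mx n'.+1.
have J'J : J' *m J = 1%:M by rewrite pid_mx_id // pid_mx_1.
have K'K : K' *m K = 1%:M by rewrite pid_mx_id // pid_mx_1.
have ABe' i : (\rank (J *m A i *m J' - K *m B i *m K')%R <= e)%N.
  rewrite -!hat_corner //; apply: leq_trans (ABe i).
  rewrite /rank_hat_sub; apply: eq_leq; congr (\rank _).
  by apply/matrixP => k l; rewrite !mxE.
have AB := mxrank_corner_sub_nc_eval J'J K'K ABe' Q1.
rewrite -(mxrank_corner (nc_eval A Q) J'J) -(mxrank_corner (nc_eval B Q) K'K).
split.
  apply: leq_trans (mxrank_le_sub _ (K *m nc_eval B Q *m K')) _.
  by rewrite leq_add2l.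
apply: leq_trans (mxrank_le_sub _ (J *m nc_eval A Q *m J')) _.
by rewrite leq_add2l -mxrank_opp opprB.
Qed.

(** * Approximate left multiplication on Folner subspaces *)

Definition lincomb (F : fieldType) (V : lmodType F) (m : nat) (e : 'I_m -> V)
    (v : 'cV[F]_m) : V := \sum_i v i 0 *: e i.

Lemma lincomb_is_linear (F : fieldType) (V : lmodType F) (m : nat)
    (e : 'I_m -> V) : linear (lincomb e).
Proof.
move=> c u v; rewrite /lincomb scaler_sumr -big_split; apply: eq_bigr => i _.
by rewrite !mxE scalerDl scalerA.
Qed.

HB.instance Definition _ (F : fieldType) (V : lmodType F) (m : nat)
    (e : 'I_m -> V) :=
  GRing.isLinear.Build F 'cV[F]_m V _ (lincomb e) (lincomb_is_linear e).

Lemma lincomb_delta (F : fieldType) (V : lmodType F) (m : nat) (e : 'I_m -> V)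
    (i : 'I_m) : lincomb e (delta_mx i 0) = e i.
Proof.
rewrite /lincomb (bigD1 i) //= mxE !eqxx scale1r big1 ?addr0 // => j ji.
by rewrite mxE (negbTE ji) scale0r.
Qed.

Lemma lincomb_inj (F : fieldType) (V : lmodType F) (m : nat) (e : 'I_m -> V) :
  linearly_independent e -> forall v, lincomb e v = 0 -> v = 0.
Proof.
move=> ei v v0; apply/matrixP => i j; rewrite ord1 mxE.
exact: (ei (fun i => v i 0)).
Qed.

Lemma mem_linear_span (F : fieldType) (V : lmodType F) (X : set V) (x : V) :
  X x -> linear_span X x.
Proof.
move=> Xx; exists 1%N, (fun=> 1), (fun=> x); split=> //.
by rewrite big_ord1 scale1r.
Qed.

Lemma linear_span0 (F : fieldType) (V : lmodType F) (X : set V) :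
  linear_span X 0.
Proof.
exists 0%N, (fun=> 0), (fun=> 0); split; first by case.
by rewrite big_ord0.
Qed.

Lemma linear_span_range (F : fieldType) (V : lmodType F) (l : nat)
    (f : 'I_l -> V) (x : V) :
  linear_span (range f) x -> exists v, lincomb f v = x.
Proof.
move=> [k [a [y [yf ->]]]].
have /choice[g gE] : forall j, exists i, f i = y j.
  by move=> j; have [i _ fi] := yf j; exists i.
exists (\sum_j a j *: delta_mx (g j) 0).
rewrite linear_sum; apply: eq_bigr => j _.
by rewrite linearZ /= lincomb_delta gE.
Qed.

Lemma lincomb_change (F : fieldType) (V : lmodType F) (m l : nat)
    (x : 'I_m -> V) (f : 'I_l -> V) :
    (forall i, linear_span (range f) (x i)) ->
  exists T : 'M_(l, m), forall v, lincomb x v = lincomb f (T *m v).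
Proof.
move=> xf; have /choice[c cE] := fun i => linear_span_range (xf i).
exists (\matrix_(j, i) c i j 0) => v.
have -> : (\matrix_(j, i) c i j 0) *m v = \sum_i v i 0 *: c i.
  apply/matrixP => j k; rewrite ord1 mxE summxE; apply: eq_bigr => i _.
  by rewrite !mxE mulrC.
by rewrite linear_sum; apply: eq_bigr => i _; rewrite linearZ /= cE.
Qed.

(* Left multiplication by [b] agrees with [M] on a subspace of codimension at
   most [c] of the span of [e]. *)
Definition approx (F : fieldType) (B : algType F) (m : nat) (e : 'I_m -> B)
    (c : nat) (b : B) (M : 'M[F]_m) : Prop :=
  exists (p : nat) (C : 'M[F]_(p, m)), (p <= c)%N /\
    forall v, C *m v = 0 -> b * lincomb e v = lincomb e (M *m v).

Section Approx.
Variables (F : fieldType) (B : algType F) (m : nat) (e : 'I_m -> B).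

Lemma approx_scalar (a : F) : approx e 0 a%:A a%:M.
Proof.
exists 0%N, 0; split=> // v _.
by rewrite mul_scalar_mx linearZ /= mulr_algl.
Qed.

Lemma approxD (c c' : nat) (b b' : B) (M M' : 'M_m) :
  approx e c b M -> approx e c' b' M' -> approx e (c + c') (b + b') (M + M').
Proof.
move=> [p [C [pc CP]]] [p' [C' [pc' CP']]].
exists (p + p')%N, (col_mx C C'); split; first exact: leq_add.
move=> v; rewrite mul_col_mx => /eqP.
rewrite col_mx_eq0 => /andP[/eqP Cv /eqP Cv'].
by rewrite mulrDl mulmxDl linearD /= CP ?CP'.
Qed.

Lemma approxM (c c' : nat) (b b' : B) (M M' : 'M_m) :
  approx e c b M -> approx e c' b' M' -> approx e (c + c') (b * b') (M *m M').
Proof.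
move=> [p [C [pc CP]]] [p' [C' [pc' CP']]].
(* The conditions for [b] must hold at [M' *m v], whence the rows [C *m M']. *)
exists (p + p')%N, (col_mx (C *m M') C'); split; first exact: leq_add.
move=> v; rewrite mul_col_mx => /eqP.
rewrite col_mx_eq0 => /andP[/eqP Cv /eqP Cv'].
by rewrite -mulrA CP' // CP ?mulmxA.
Qed.

Lemma approx_leq (c c' : nat) (b : B) (M : 'M_m) :
  (c <= c')%N -> approx e c b M -> approx e c' b M.
Proof.
by move=> cc' [p [C [pc CP]]]; exists p, C; split=> //; apply: leq_trans cc'.
Qed.

(** On the kernel of [C], independence of [e] forces [M *m v = 0]; hence the row space of [M] lies
    in that of [C]. *)
Lemma approx0_mxrank (c : nat) (M : 'M_m) :
  linearly_independent e -> approx e c 0 M -> (\rank M <= c)%N.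
Proof.
move=> ei [p [C [pc CP]]]; apply: leq_trans pc.
apply: leq_trans (rank_leq_row C).
have /submxP[D ->] : (M <= C)%MS; last exact: mxrankM_maxr.
rewrite submxE; apply/eqP/matrixP => i j.
have MC : M *m col j (cokermx C) = 0.
  apply: (lincomb_inj ei); rewrite -CP ?mul0r //.
  by rewrite colE mulmxA mulmx_coker mul0mx.
by move/matrixP/(_ i 0): MC; rewrite colE mulmxA -colE !mxE.
Qed.

(** [M - 1] approximates zero, so its rank is at most [c]. *)
Lemma approx1_mxrank (c : nat) (M : 'M_m) :
  linearly_independent e -> approx e c 1 M -> (m <= \rank M + c)%N.
Proof.
move=> ei aM; have := approxD aM (approx_scalar (-1)).
rewrite scaleN1r subrr addn0 => /(approx0_mxrank ei) rM.
have := mxrank_add M (1%:M - M); rewrite addrC subrK mxrank1 => /leq_trans->//.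
by rewrite leq_add2l -mxrank_opp opprB -raddfN.
Qed.
End Approx.

Lemma approx_nc_eval (F : fieldType) (B : algType F) (m : nat)
    (e : 'I_m.+1 -> B) (d c : nat) (x : 'I_d -> B) (A : 'I_d -> 'M[F]_m.+1)
    (Q : ncpoly F d) :
    (forall i, approx e c (x i) (A i)) ->
  approx e (nc_length Q * c) (nc_eval x Q) (nc_eval A Q).
Proof.
move=> xA; rewrite !nc_eval_sum /nc_length.
have word (s : seq 'I_d) :
    approx e (size s * c) (\prod_(i <- s) x i) (\prod_(i <- s) A i).
  elim: s => [|i s IH].
    by rewrite !big_nil; have := approx_scalar e 1; rewrite scale1r.
  by rewrite !big_cons mulSn; exact: approxM.
elim: (msupp Q : seq _) => [|w r IH].
  by rewrite !big_nil; have := approx_scalar e 0; rewrite scale0r raddf0.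
rewrite !big_cons mulnDl; apply: approxD => //.
rewrite -mulr_algl -[X in approx _ _ _ X]mulr_algl -(add0n (_ * c)%N).
apply: approxM; last exact: word.
by rewrite scalemx1; exact: approx_scalar.
Qed.

(* A basis [f] of [V + SV] and matrices [E], [T i] over it for the inclusion
   of [V] and for the multiplications by [s i]; a left inverse [X] of [E]
   projects [V + SV] back onto [V]. *)
Lemma folner_approx (F : fieldType) (B : algType F) (k : nat) (s : 'I_k -> B)
    (V : set B) (m l : nat) :
    has_dim V m -> has_dim (sum_subspace (span_mul (range s) V) V) l ->
  exists (e : 'I_m -> B) (A : 'I_k -> 'M[F]_m),
    linearly_independent e /\ forall i, approx e (l - m) (s i) (A i).
Proof.
move=> [e [ei VE]] [f [fi WE]].
have eW i : linear_span (range f) (e i).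
  rewrite -WE; exists 0; first exact: linear_span0.
  exists (e i); last by rewrite add0r.
  by rewrite VE; apply: mem_linear_span; exists i.
have seW j i : linear_span (range f) (s j * e i).
  rewrite -WE; exists (s j * e i).
    apply: mem_linear_span; exists (s j); first by exists j.
    exists (e i) => //.
    by rewrite VE; apply: mem_linear_span; exists i.
  by exists 0; rewrite ?addr0 // VE; apply: linear_span0.
have [E EP] := lincomb_change eW.
have /choice[T TP] := fun j => lincomb_change (seW j).
have E0 (v : 'cV_m) : E *m v = 0 -> v = 0.
  by move=> Ev; apply: (lincomb_inj ei); rewrite EP Ev linear0.
(* [E] is injective by [E0]: a nonzero kernel would have a basis [U] with a left inverse, yet
   [U = 0]. *)
have rE : row_full E.
  rewrite -col_leq_rank leqNgt; apply/negP.
  move=> /column_kernel[p [U [X [XU EU _]]]].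
  have U0 : U = 0.
    apply/matrixP => i j; have /matrixP/(_ i 0) : col j U = 0.
      by apply: E0; rewrite colE mulmxA EU mul0mx.
    by rewrite !mxE.
  move: XU; rewrite U0 mulmx0 => /esym/eqP.
  by rewrite -[_ == 0]negbK -mxrank_eq0 mxrank1.
have [X XE] := row_fullP rE.
exists e, (fun j => X *m T j); split=> // j.
(* [D] is a projector whose kernel is the image of [V]: [D *m T j *m v = 0] says that the product
   stays in [V]. Since [D *m E = 0], its rank is at most [l - m], and [row_base D] keeps only that
   many conditions. *)
pose D : 'M_l := 1%:M - E *m X.
exists (\rank D), (row_base D *m T j); split.
  have DE : D *m E = 0 by rewrite mulmxBl mul1mx -mulmxA XE mulmx1 subrr.
  have := mulmx0_rank_max DE; rewrite (eqP rE) => rDE.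
  by rewrite -(addnK m (\rank D)) leq_sub2r.
move=> v Dv.
have DTv : D *m (T j *m v) = 0.
  rewrite -mulmxA in Dv.
  by rewrite -(mulmx_base D) -mulmxA Dv mulmx0.
have -> : s j * lincomb e v = lincomb (fun i => s j * e i) v.
  by rewrite /lincomb mulr_sumr; apply: eq_bigr => i _; rewrite -scalerAr.
rewrite TP EP; congr (lincomb f _); apply/eqP.
by rewrite -subr_eq0 -DTv mulmxBl mul1mx -!mulmxA.
Qed.

(** Amenability speaks of its own generators [s]. Writing each [x i] as a polynomial in [s]
    multiplies the error by at most [L], so the Folner condition is used with [eta / (L + 1)]. *)
Lemma amenable_approx (R : realType) (F : fieldType) (B : algType F) (d : nat)
    (x : 'I_d -> B) (eta : R) :
    amenable R B -> 0 < eta ->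
  exists (m c : nat) (e : 'I_m.+1 -> B) (A : 'I_d -> 'M[F]_m.+1),
    [/\ linearly_independent e, forall i, approx e c (x i) (A i)
      & c%:R < eta * m.+1%:R].
Proof.
move=> [k [s [sgen am]]] eta0.
have /choice[Q QE] := fun i => sgen (x i).
pose L := (\sum_i nc_length (Q i))%N.
have L0 : 0 < L%:R + 1 :> R by rewrite ltr_wpDl.
have [V [m [l [Vm Wl lm]]]] := am (eta / (L%:R + 1)) (divr_gt0 eta0 L0).
have [e [A [ei eA]]] := folner_approx Vm Wl.
case: m Vm lm e A ei eA => [_ |m _ lm e A ei eA]; first by rewrite mulr0 ltrn0.
exists m, (L * (l - m.+1))%N, e, (fun i => nc_eval A (Q i)); split=> // [i|].
  rewrite -QE; apply: approx_leq (approx_nc_eval (Q i) eA).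
  by rewrite leq_mul2r /L (bigD1 i) //= leq_addr orbT.
have lmR : (l - m.+1)%:R < eta / (L%:R + 1) * m.+1%:R.
  (* Here the truncated difference is zero. *)
  have [lem|/ltnW lem] := leqP l m.+1.
    move: lem; rewrite -subn_eq0 => /eqP->.
    by rewrite mulr_gt0 ?divr_gt0 ?ltr0Sn.
  by rewrite natrB // ltrBlDl -{1}(mul1r m.+1%:R) -mulrDl.
rewrite natrM; apply: le_lt_trans (_ : _ <= (L%:R + 1) * (l - m.+1)%:R) _.
  by rewrite ler_wpM2r // lerDl.
by rewrite mulrC -ltr_pdivlMr // mulrAC.
Qed.

(** * Polynomials without constant term, and the contradiction *)

Lemma nc_eval_0 (F : fieldType) (d : nat) (B : algType F) (Q : ncpoly F d) :
  Q@_mone = 0 -> nc_eval (fun=> 0 : B) Q = 0.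
Proof.
move=> Q1; rewrite nc_eval_sum big_seq big1 // => m mQ.
case mE: (m : seq _) => [|i w].
  have m1 : m = mone by apply: fdeg_eq0I; rewrite fdegE mE.
  by move: mQ; rewrite -mcoeff_neq0 m1 Q1 eqxx.
by rewrite /word_eval mE big_cons mul0r scaler0.
Qed.

(* Otherwise the constant term would induce a representation in 'M_1. *)
Lemma constant_free_one (F : fieldType) (d : nat) (B : algType F)
    (x : 'I_d -> B) :
    generates x -> ~ has_findim_rep B ->
  exists h : ncpoly F d, h@_mone = 0 /\ nc_eval x h = 1.
Proof.
move=> xgen norep; apply: contrapT => noh; apply: norep; exists 0%N.
apply: (lrmorphism_factor (e := nc_eval x) (f := nc_eval (fun=> 0))) => // Q Qx0.
apply: nc_eval_0; have [//|Q1] := eqVneq Q@_mone 0.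
(* A relation with nonzero constant term, once normalized and subtracted from 1, is the excluded
   [h]. *)
case: noh; exists (1 - (Q@_mone)^-1 *: Q); split.
  by rewrite mcoeffB mcoeffZ mulVf // rmorph1 subrr.
by rewrite linearB linearZ /= Qx0 scaler0 subr0 rmorph1.
Qed.

Lemma nc_eval_ideal_generated (F : fieldType) (d r : nat) (B : algType F)
    (b : 'I_d -> B) (P : 'I_r -> ncpoly F d) (Q : ncpoly F d) :
  (forall i, nc_eval b (P i) = 0) -> ideal_generated P Q -> nc_eval b Q = 0.
Proof.
move=> bP QP; apply: (QP [set y | nc_eval b y = 0]%classic) => //.
split=> /= [|y z y0 z0|y z z0].
- exact: linear0.
- by rewrite linearD /= y0 z0 addr0.
- by rewrite !rmorphM /= z0 mulr0 mul0r.
Qed.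

Theorem theorem8p2 (R : realType) (F : fieldType) (A : algType F)
    (hA : finitely_presented A)
    (I : set A) (hI : two_sided_ideal I) (hI0 : exists x : A, I x /\ x <> 0)
    (B : algType F) (q : {lrmorphism A -> B}) (hq : is_quotient I q)
    (hfg : fg_left_ideal I)
    (hamen : amenable R B)
    (hrep : ~ has_findim_rep B) :
  ~ rank_stable R A.
Proof.
move=> [d [r [P [a [[agen aker] stable]]]]]; have [qS qI] := hq.
pose x := q \o a.
have xgen : generates x.
  move=> y; have [z <-] := qS y; have [Q <-] := agen z.
  by exists Q; rewrite nc_eval_comp.
have [h [h1 hx]] := constant_free_one xgen hrep.
have [k [g IE]] := hfg; have /choice[G GE] := fun i => agen (g i).
have Gx i : nc_eval x (G i) = 0.
  rewrite nc_eval_comp GE; apply/qI; rewrite IE; exists (fun j => (j == i)%:R).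
  rewrite (bigD1 i) //= eqxx mul1r big1 ?addr0 // => j ji.
  by rewrite (negbTE ji) mul0r.
(* The factor [h] removes the constant term of [G i], so ranks can be compared across sizes. *)
pose Gh i := G i * h.
have Gh1 i : (Gh i)@_mone = 0 by rewrite rmorphM /= h1 mulr0.
have Ghx i : nc_eval x (Gh i) = 0 by rewrite rmorphM /= Gx mul0r.
pose K := (nc_length h + \sum_i nc_length (Gh i))%N.
pose L := (\sum_j nc_length (P j))%N.
have K0 : 0 < K%:R + 1 :> R by rewrite ltr_wpDl.
have L0 : 0 < L%:R + 1 :> R by rewrite ltr_wpDl.
(* Half of [1 / (K + 1)], since the final count involves two errors: [c] from the Folner space and
   [f] from stability. *)
pose eps : R := (K%:R + 1)^-1 / 2.
have eps0 : 0 < eps by rewrite divr_gt0 ?invr_gt0.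
have [delta [delta0 {}stable]] := stable _ eps0.
(* The first bound brings the relations at [M] below [delta]; the second serves the final count. *)
have eta0 : 0 < Num.min (delta / (L%:R + 1)) eps.
  by rewrite lt_min eps0 divr_gt0.
have [m [c [e [M [ei eM]]]]] := amenable_approx x hamen eta0.
rewrite -(@ltr_pdivrMr R) ?ltr0Sn // lt_min !ltr_pdivrMr ?ltr0Sn //.
move=> /andP[cdelta ceps].
have PM j : (\rank (nc_eval M (P j)) <= L * c)%N.
  have xP : nc_eval x (P j) = 0.
    rewrite nc_eval_comp; suff -> : nc_eval a (P j) = 0 by rewrite linear0.
    by apply/aker => J _; exact.
  have := approx_nc_eval (P j) eM; rewrite xP => /(approx0_mxrank ei).
  by move/leq_trans; apply; rewrite leq_mul2r /L (bigD1 j) //= leq_addr orbT.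
have [|n' [N [NP MN]]] := stable m M.
  move=> j; rewrite /rk ltr_pdivrMr ?ltr0Sn //.
  apply: le_lt_trans (_ : _ <= (L%:R + 1) * c%:R) _.
    apply: le_trans (_ : (L * c)%:R <= _); first by rewrite ler_nat.
    by rewrite natrM ler_wpM2r // lerDl.
  by rewrite mulrC -ltr_pdivlMr // mulrAC.
pose f := (\max_i rank_hat_sub (M i) (N i))%N.
have fN i : (rank_hat_sub (M i) (N i) <= f)%N by exact: leq_bigmax.
have feps : f%:R < eps * m.+1%:R.
  rewrite /f; elim/big_ind: _ => //; first by rewrite mulr_gt0 ?ltr0Sn.
  by move=> y z ym zm; rewrite /maxn; case: ifP.
have rkh : (\rank (nc_eval N h) <= \sum_i \rank (nc_eval N (Gh i)))%N.
  under eq_bigr => i _ do rewrite rmorphM /=.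
  apply: (mxrank_le_sum_mul (e := nc_eval x) (f := nc_eval N)) => // t.
  rewrite /= nc_eval_comp => /qI; rewrite IE => -[u tE].
  (* Lifting the coefficients [u i] to polynomials makes the difference of [t] and the sum of the
     [C i * G i] a relation of [A], which vanishes at the exact solution [N]. *)
  have /choice[C CE] := fun i => agen (u i).
  exists C; rewrite -linear_sum; apply/eqP.
  rewrite -subr_eq0 -linearB; apply/eqP.
  apply: nc_eval_ideal_generated NP _; apply/aker.
  rewrite linearB (linear_sum (nc_eval a)) /= tE.
  apply/eqP; rewrite subr_eq0; apply/eqP.
  by apply: eq_bigr => i _; rewrite rmorphM /= CE GE.
have rkGh : (\sum_i \rank (nc_eval N (Gh i))
    <= (\sum_i nc_length (Gh i)) * (c + f))%N.
  rewrite big_distrl leq_sum //= => i _.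
  have [_ /leq_trans->//] := mxrank_nc_eval_hat fN (Gh1 i).
  have := approx_nc_eval (Gh i) eM; rewrite Ghx => /(approx0_mxrank ei) rGh.
  by rewrite mulnDr leq_add2r.
(* [m.+1] is at most the rank of [h] at [M] plus [nc_length h * c]; passing to [N] costs
   [nc_length h * f], and [rkh], [rkGh] bound the rest. *)
have : (m.+1 <= K * (c + f))%N.
  have := approx_nc_eval h eM; rewrite hx => /(approx1_mxrank ei) mhM.
  have [hMN _] := mxrank_nc_eval_hat fN h1.
  apply: leq_trans mhM _; apply: leq_trans (leq_add hMN (leqnn _)) _.
  rewrite /K mulnDl -addnA addnC leq_add //; first by rewrite mulnDr addnC.
  exact: leq_trans rkh rkGh.
apply/negP; rewrite -ltnNge -(ltr_nat R).
apply: le_lt_trans (_ : _ <= (K%:R + 1) * (c + f)%:R) _.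
  by rewrite natrM ler_wpM2r // lerDl.
rewrite mulrC -ltr_pdivlMr // natrD.
have -> : m.+1%:R / (K%:R + 1) = eps * m.+1%:R + eps * m.+1%:R :> R.
  by rewrite -mulrDl -splitr mulrC.
exact: ltrD.
Qed.
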